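(* If $\phi$ is a Boolean combination of formulas of the form $L_s\psi$ (with arbitrary formulas $\psi$ of $\mathcal{L}$ and indices $s\in\mathbb{Q}\cap[0,1]$), then for every rational $r$ with $0<r\le1$, the formula $\phi\leftrightarrow L_r\phi$ is a theorem of $\Sigma_H$.
   Context: Language $\mathcal{L}$: formulas are given by $\phi ::= p \mid \neg\phi \mid \phi_1\wedge\phi_2 \mid L_r\phi$, with $p$ from a countably infinite set of propositional letters and $r\in\mathbb{Q}\cap[0,1]$. A logic is a set of formulas containing all propositional tautologies and closed under modus ponens and uniform substitution. $\Sigma_H$ is the smallest logic containing (A1) $L_0\phi$; (A2) $L_r\top$; (A3) $L_r(\phi\wedge\psi)\wedge L_t(\phi\wedge\neg\psi)\to L_{r+t}\phi$ for $r+t\le 1$; (A4) $\neg L_r(\phi\wedge\psi)\wedge\neg L_s(\phi\wedge\neg\psi)\to\neg L_{r+s}\phi$ for $r+s\le1$; (A5) $L_r\phi\to\neg L_s\neg\phi$ for $r+s>1$; $(4_p)$ $L_r\phi\to L_1L_r\phi$; $(5_p)$ $\neg L_r\phi\to L_1\neg L_r\phi$; and closed under (DIS): from $\phi\leftrightarrow\psi$ infer $L_r\phi\leftrightarrow L_r\psi$; and (ARCH): if $\gamma\to L_s\phi$ is a theorem for all $s<r$, then $\gamma\to L_r\phi$ is a theorem. All indices are rationals in $[0,1]$. *)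

(* Defs.v *)
From HB Require Import structures.
From mathcomp Require Import all_boot all_order all_algebra.

Set Implicit Arguments.
Unset Strict Implicit.
Unset Printing Implicit Defensive.

Import Order.TTheory GRing.Theory Num.Theory.
Local Open Scope ring_scope.

Record idx := Idx { idx_val :> rat; idx_valP : 0 <= idx_val <= 1 }.

HB.instance Definition _ := [isSub for idx_val].
HB.instance Definition _ := [Equality of idx by <:].

Definition idx0 : idx := @Idx 0 isT.
Definition idx1 : idx := @Idx 1 isT.

Inductive formula : Type :=
| Var of nat
| Neg of formula
| And of formula & formula
| L of idx & formula.

Definition Top : formula := Neg (And (Var 0) (Neg (Var 0))).
Definition Imp (phi psi : formula) : formula := Neg (And phi (Neg psi)).
Definition Iff (phi psi : formula) : formula := And (Imp phi psi) (Imp psi phi).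

(* Propositional truth value: [v] interprets the letters and [w] interprets
   the formulas [L r phi], which count as propositional atoms. *)
Fixpoint peval (v : nat -> bool) (w : idx -> formula -> bool)
    (phi : formula) : bool :=
  match phi with
  | Var n => v n
  | Neg psi => ~~ peval v w psi
  | And psi chi => peval v w psi && peval v w chi
  | L r psi => w r psi
  end.

Definition tautology (phi : formula) : Prop := forall v w, peval v w phi.

Fixpoint subst (sigma : nat -> formula) (phi : formula) : formula :=
  match phi with
  | Var n => sigma n
  | Neg psi => Neg (subst sigma psi)
  | And psi chi => And (subst sigma psi) (subst sigma chi)
  | L r psi => L r (subst sigma psi)
  end.

Record is_logic (S : formula -> Prop) : Prop := {
  logic_taut : forall phi, tautology phi -> S phi;
  logic_mp : forall phi psi, S (Imp phi psi) -> S phi -> S psi;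
  logic_subst : forall sigma phi, S phi -> S (subst sigma phi)
}.

(* In [A3] and [A4] the index [q] stands for the sum of the two others: such a
   [q : idx] exists exactly when that sum is at most 1. *)
Inductive axiomH : formula -> Prop :=
| A1 phi : axiomH (L idx0 phi)
| A2 r : axiomH (L r Top)
| A3 (r t q : idx) phi psi : (q : rat) = (r : rat) + (t : rat) ->
    axiomH (Imp (And (L r (And phi psi)) (L t (And phi (Neg psi)))) (L q phi))
| A4 (r s q : idx) phi psi : (q : rat) = (r : rat) + (s : rat) ->
    axiomH (Imp (And (Neg (L r (And phi psi))) (Neg (L s (And phi (Neg psi)))))
                (Neg (L q phi)))
| A5 (r s : idx) phi : 1 < (r : rat) + (s : rat) ->
    axiomH (Imp (L r phi) (Neg (L s (Neg phi))))
| Ax4p r phi : axiomH (Imp (L r phi) (L idx1 (L r phi)))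
| Ax5p r phi : axiomH (Imp (Neg (L r phi)) (L idx1 (Neg (L r phi)))).

Definition closed_DIS (S : formula -> Prop) : Prop :=
  forall (r : idx) phi psi, S (Iff phi psi) -> S (Iff (L r phi) (L r psi)).

Definition closed_ARCH (S : formula -> Prop) : Prop :=
  forall (gamma phi : formula) (r : idx),
    (forall s : idx, (s : rat) < (r : rat) -> S (Imp gamma (L s phi))) ->
    S (Imp gamma (L r phi)).

Definition SigmaH (phi : formula) : Prop :=
  forall S : formula -> Prop,
    is_logic S -> (forall psi, axiomH psi -> S psi) ->
    closed_DIS S -> closed_ARCH S -> S phi.

Inductive bool_comb_L : formula -> Prop :=
| BC_L s psi : bool_comb_L (L s psi)
| BC_Neg phi : bool_comb_L phi -> bool_comb_L (Neg phi)
| BC_And phi psi : bool_comb_L phi -> bool_comb_L psi ->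
    bool_comb_L (And phi psi).

(* Main.v *)
Require Import Defs.
From mathcomp Require Import all_boot all_order all_algebra.

(** A Boolean combination [phi] of formulas [L s psi] describes only the
    probabilistic beliefs of the agent, and the introspection axioms (4_p) and
    (5_p) make the agent certain of these. The heart of the proof is therefore
    [introspection]: both [phi -> L_1 phi] and [~ phi -> L_1 (~ phi)] are
    theorems. Proving the two together is what lets the induction pass through
    negations. At a conjunction it needs that [L_1] is monotone and that two
    certainties combine into one, [L_1 phi /\ L_1 psi -> L_1 (phi /\ psi)];
    the latter is where the Archimedean rule enters, because (A5) bounds the
    probability of [~ psi] only by every positive rational.

    Introspection gives the equivalence for every [r > 0]. If [phi] holds, it has
    probability 1, hence at least [r]. If [phi] fails, [~ phi] has probability
    1, so (A5) forbids [phi] to have probability at least [r], as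
    [1 + r > 1]. *)

Import Order.POrderTheory GRing.Theory Num.Theory.
Local Open Scope ring_scope.

(** * Sigma_H is closed under its own rules *)

Lemma SigmaH_taut phi : tautology phi -> SigmaH phi.
Proof. by move=> tphi S [taut _ _] _ _ _; exact: taut. Qed.

Lemma SigmaH_mp phi psi : SigmaH (Imp phi psi) -> SigmaH phi -> SigmaH psi.
Proof.
move=> Hpq Hp S lS aS dS rS; case: (lS) => _ mp _.
by apply: (mp phi); [exact: Hpq | exact: Hp].
Qed.

Lemma SigmaH_axiom phi : axiomH phi -> SigmaH phi.
Proof. by move=> Aphi S _ aS _ _; exact: aS. Qed.

Lemma SigmaH_DIS : closed_DIS SigmaH.
Proof. by move=> r phi psi H S lS aS dS rS; apply: (dS); exact: H. Qed.

Lemma SigmaH_ARCH : closed_ARCH SigmaH.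
Proof.
by move=> gamma phi r H S lS aS dS rS; apply: (rS) => s sr; exact: H.
Qed.

(** After simplification the truth values left in the goal are those of formula
    variables, letters and [L]-formulas; these are the atoms of the table. *)
Ltac truth_table :=
  let v := fresh "v" in let w := fresh "w" in
  move=> v w /=;
  repeat match goal with
  | |- context [peval v w ?phi] => case: (peval v w phi)
  | |- context [v ?n] => case: (v n)
  | |- context [w ?r ?phi] => case: (w r phi)
  end; by [].

Lemma conseq1 {a b} : SigmaH a -> tautology (Imp a b) -> SigmaH b.
Proof. by move=> Ha /SigmaH_taut /SigmaH_mp; apply. Qed.

Lemma conseq2 {a b c} :
  SigmaH a -> SigmaH b -> tautology (Imp a (Imp b c)) -> SigmaH c.
Proof. by move=> Ha Hb /(conseq1 Ha)/SigmaH_mp; apply. Qed.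

Lemma conseq3 {a b c d} : SigmaH a -> SigmaH b -> SigmaH c ->
  tautology (Imp a (Imp b (Imp c d))) -> SigmaH d.
Proof. by move=> Ha Hb Hc /(conseq2 Ha Hb)/SigmaH_mp; apply. Qed.

(** * Monotonicity and certainty *)

Lemma idx_diff (r s : idx) : (r : rat) <= (s : rat) ->
  exists t : idx, (s : rat) = (r : rat) + (t : rat).
Proof.
move=> rs; have r0 : 0 <= (r : rat) by case/andP: (idx_valP r).
have s1 : (s : rat) <= 1 by case/andP: (idx_valP s).
have d01 : 0 <= (s : rat) - (r : rat) <= 1.
  by rewrite subr_ge0 rs lerBlDr
     (le_trans s1) // lerDl.
by exists (@Idx _ d01); rewrite /= addrC subrK.
Qed.

Lemma idx_diff_gt0 (r s t : idx) : (s : rat) = (r : rat) + (t : rat) ->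
  (r : rat) < (s : rat) -> 0 < (t : rat).
Proof. by move=> ->; rewrite ltrDl. Qed.

(** Since [phi] and [psi /\ phi] are equivalent, this is additivity (A3) for
    [psi] split along [phi], with the trivial bound 0 on [psi /\ ~ phi]. *)
Lemma L_mono r phi psi :
  SigmaH (Imp phi psi) -> SigmaH (Imp (L r phi) (L r psi)).
Proof.
move=> H.
have Hsplit : SigmaH (Iff phi (And psi phi)) by apply: (conseq1 H); truth_table.
have add0 : (r : rat) = (r : rat) + (idx0 : rat) by rewrite /= addr0.
apply: (conseq3 (SigmaH_DIS r _ _ Hsplit)
  (SigmaH_axiom _ (A3 psi phi add0))
  (SigmaH_axiom _ (A1 (And psi (Neg phi))))).
truth_table.
Qed.

Lemma certain_not_L_Neg (s : idx) phi : 0 < (s : rat) ->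
  SigmaH (Imp (L idx1 phi) (Neg (L s (Neg phi)))).
Proof.
by move=> s0; apply: SigmaH_axiom; apply: A5; rewrite ltrDl.
Qed.

(** If [phi] had probability below [r], then (A4), applied to [phi] split along
    [Top], would put its probability below [s]: the part outside [Top] has
    probability below every positive index. *)
Lemma L_antimono (r s : idx) phi : (r : rat) <= (s : rat) ->
  SigmaH (Imp (L s phi) (L r phi)).
Proof.
rewrite le_eqVlt => /orP[/eqP/val_inj <- | rs].
  by apply: SigmaH_taut; truth_table.
have [t Est] := idx_diff r s (ltW rs).
have t0 := idx_diff_gt0 r s t Est rs.
have Hin : SigmaH (Imp (L r (And phi Top)) (L r phi)).
  by apply: L_mono; apply: SigmaH_taut; truth_table.
have Hout : SigmaH (Neg (L t (And phi (Neg Top)))).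
  have Hmono : SigmaH (Imp (L t (And phi (Neg Top))) (L t (Neg Top))).
    by apply: L_mono; apply: SigmaH_taut; truth_table.
  apply: (conseq3 Hmono (certain_not_L_Neg t Top t0)
    (SigmaH_axiom _ (A2 idx1))).
  truth_table.
apply: (conseq3 Hin Hout (SigmaH_axiom _ (A4 phi Top Est))).
truth_table.
Qed.

(** Let [s < 1] and [t = 1 - s > 0]. Certainty of [psi] leaves [phi /\ ~ psi]
    with probability below [t], so if [phi /\ psi] had probability below [s],
    (A4) would contradict the certainty of [phi]. Hence [phi /\ psi] has
    probability at least [s] for all [s < 1], and the Archimedean rule
    concludes. *)
Lemma certain_And phi psi :
  SigmaH (Imp (And (L idx1 phi) (L idx1 psi)) (L idx1 (And phi psi))).
Proof.
apply: SigmaH_ARCH => s s1.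
have [t Et] := idx_diff s idx1 (ltW s1).
have t0 := idx_diff_gt0 s idx1 t Et s1.
have Hmono : SigmaH (Imp (L t (And phi (Neg psi))) (L t (Neg psi))).
  by apply: L_mono; apply: SigmaH_taut; truth_table.
apply: (conseq3 Hmono (certain_not_L_Neg t psi t0)
  (SigmaH_axiom _ (A4 phi psi Et))).
truth_table.
Qed.

(** * Introspection *)

(** The second half at a conjunction holds because a false conjunction has a
    false conjunct, of whose falsity the agent is certain. *)
Lemma introspection phi : bool_comb_L phi ->
  SigmaH (Imp phi (L idx1 phi)) /\ SigmaH (Imp (Neg phi) (L idx1 (Neg phi))).
Proof.
elim=> [s psi | {}phi _ [IHpos IHneg] |
        {}phi psi _ [IHpos1 IHneg1] _ [IHpos2 IHneg2]].
- by split; apply: SigmaH_axiom; [exact: Ax4p | exact: Ax5p].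
- split=> //.
  have Hnn : SigmaH (Imp (L idx1 phi) (L idx1 (Neg (Neg phi)))).
    by apply: L_mono; apply: SigmaH_taut; truth_table.
  by apply: (conseq2 IHpos Hnn); truth_table.
- split.
    by apply: (conseq3 IHpos1 IHpos2 (certain_And phi psi)); truth_table.
  have weaken chi : SigmaH (Imp (Neg chi) (Neg (And phi psi))) ->
      SigmaH (Imp (Neg chi) (L idx1 (Neg chi))) ->
      SigmaH (Imp (Neg chi) (L idx1 (Neg (And phi psi)))).
    by move=> /(L_mono idx1) Hm Hchi; apply: (conseq2 Hchi Hm); truth_table.
  have Hl : SigmaH (Imp (Neg phi) (L idx1 (Neg (And phi psi)))).
    by apply: weaken => //; apply: SigmaH_taut; truth_table.
  have Hr : SigmaH (Imp (Neg psi) (L idx1 (Neg (And phi psi)))).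
    by apply: weaken => //; apply: SigmaH_taut; truth_table.
  by apply: (conseq2 Hl Hr); truth_table.
Qed.

Theorem theorem3p12 (phi : formula) (hphi : bool_comb_L phi)
  (r : idx) (hr : 0 < idx_val r) :
  SigmaH (Iff phi (L r phi)).
Proof.
have [Hpos Hneg] := introspection phi hphi.
have r1 : (r : rat) <= (idx1 : rat) by case/andP: (idx_valP r).
have Hfwd : SigmaH (Imp phi (L r phi)).
  by apply: (conseq2 Hpos (L_antimono r idx1 phi r1)); truth_table.
have Hbwd : SigmaH (Imp (L r phi) phi).
  have Hnn : SigmaH (Imp (L r phi) (L r (Neg (Neg phi)))).
    by apply: L_mono; apply: SigmaH_taut; truth_table.
  apply: (conseq3 Hneg (certain_not_L_Neg r (Neg phi) hr) Hnn).
  truth_table.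
by apply: (conseq2 Hfwd Hbwd); truth_table.
Qed.
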